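(* Let $d=2$ and suppose that balls, annuli and the sets $E_\mu(\delta,\eta)$ are defined with the Euclidean norm $\|\cdot\|_2$ on $\mathbb{R}^2$. Let $\overline{d}\in[0.89,2]$ and $\underline{d}\in[0.89,\overline{d}]$. Suppose that $\mu$ is a Radon probability measure on $\mathbb{R}^2$ such that $\underline{\dim}(\mu)=\underline{d}$ and $\overline{\dim}(\mu)=\overline{d}$. Then $\mu(E_\mu(30,\eta))=0$ for every $\eta\in(0,1)$.
   Context: For the Euclidean norm on $\mathbb{R}^2$, $B(x,r)=\{y\in\mathbb{R}^2:\|x-y\|_2\le r\}$ is the closed ball. For $x\in \mathbb{R}^2$, $0<r<1$ and $\delta \geq 1$, the annulus is $A(x,r,\delta) = B (x,r)\setminus B (x,r-r^\delta)$. One says that $P_{\mu}(x,r,\delta,\eta)$ holds when $\mu(A (x,r,\delta)) \geq \eta\, \mu(B(x,r))$. One sets $E_{\mu}(\delta,\eta) = \{x\in \mathbb{R}^2: P_{\mu}(x,r_n,\delta,\eta)$ holds for every $n$, for some sequence of radii $(r_n)_{n\geq 1}$ tending to $0\}$. The lower and upper dimensions of $\mu$ are $\underline{\dim}(\mu)= \sup \{\alpha\geq 0: \text{ for } \mu\text{-a.e. } x,\ \exists\, r_x>0,\ \forall\, 0<r<r_x,\ \mu(B(x,r)) \leq r^\alpha\}$ and $\overline{\dim}(\mu)= \inf \{\beta\geq 0: \text{ for } \mu\text{-a.e. } x,\ \exists\, r_x>0,\ \forall\, 0<r<r_x,\ \mu(B(x,r)) \geq r^\beta\}$. *)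

(* Defs.v *)
From HB Require Import structures.
From mathcomp Require Import all_boot all_order all_algebra.
From mathcomp Require Import all_classical all_reals all_analysis.

Set Implicit Arguments.
Unset Strict Implicit.
Unset Printing Implicit Defensive.

Import Order.TTheory GRing.Theory Num.Theory.
Import numFieldNormedType.Exports.

Local Open Scope classical_set_scope.
Local Open Scope ring_scope.

(* The product sigma-algebra of two copies of the Borel sigma-algebra of the
   line is the Borel sigma-algebra of the plane. *)
Definition plane (R : realType) : measurableType _ :=
  (measurableTypeR R * measurableTypeR R)%type.

(* The library norm on [R * R] is the sup norm, hence this definition. *)
Definition norm2 (R : realType) (x : R * R) : R :=
  Num.sqrt (x.1 ^+ 2 + x.2 ^+ 2).

Definition cball2 (R : realType) (x : R * R) (r : R) : set (R * R) :=
  [set y | norm2 (x - y) <= r].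

Definition annulus (R : realType) (x : R * R) (r delta : R) : set (R * R) :=
  cball2 x r `\` cball2 x (r - r `^ delta).

(* Compact and open refer to the product topology on [R * R], which is the
   topology of the Euclidean norm. *)
Definition radon (R : realType) (mu : {measure set (plane R) -> \bar R}) : Prop :=
  [/\ forall K : set (R * R), compact K -> (mu K < +oo)%E,
      forall U : set (R * R), open U ->
        mu U = ereal_sup [set mu K | K in [set K : set (R * R) |
                                             compact K /\ K `<=` U]] &
      forall A : set (plane R), measurable A ->
        mu A = ereal_inf [set mu U | U in [set U : set (R * R) |
                                             open U /\ A `<=` U]]].

Definition Pmu (R : realType) (mu : {measure set (plane R) -> \bar R})
    (x : R * R) (r delta eta : R) : Prop :=
  (eta%:E * mu (cball2 x r) <= mu (annulus x r delta))%E.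

(* [Emu] is not known a priori to be Borel, and a measure takes unspecified
   values outside the sigma-algebra: that it is mu-null has to be expressed with
   [mu.-negligible] rather than with [mu (Emu _ _ _) = 0]. *)
Definition Emu (R : realType) (mu : {measure set (plane R) -> \bar R})
    (delta eta : R) : set (R * R) :=
  [set x | exists r : R^nat,
     [/\ forall n, 0 < r n < 1,
         r @ \oo --> (0 : R) &
         forall n, Pmu mu x (r n) delta eta]].

(* The dimensions are extended reals so that the infimum of the empty set is
   [+oo] rather than the default value of the real-valued [inf]. *)
Definition lower_dim (R : realType) (mu : {measure set (plane R) -> \bar R})
    : \bar R :=
  ereal_sup [set a%:E | a in [set a : R | 0 <= a /\
    {ae mu, forall x : plane R, exists2 rx : R, 0 < rx &
      forall r : R, 0 < r < rx -> (mu (cball2 x r) <= (r `^ a)%:E)%E}]].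

Definition upper_dim (R : realType) (mu : {measure set (plane R) -> \bar R})
    : \bar R :=
  ereal_inf [set b%:E | b in [set b : R | 0 <= b /\
    {ae mu, forall x : plane R, exists2 rx : R, 0 < rx &
      forall r : R, 0 < r < rx -> ((r `^ b)%:E <= mu (cball2 x r))%E}]].

(* Main.v *)
Require Import Defs.
From HB Require Import structures.
From mathcomp Require Import all_boot all_order all_algebra.
From mathcomp Require Import all_classical all_reals all_analysis.
From mathcomp Require Import measurable_realfun ring lra.

Import Order.TTheory GRing.Theory Num.Theory.
Import numFieldNormedType.Exports.

Local Open Scope classical_set_scope.
Local Open Scope ring_scope.

(** Suppose that the set [Emu] of exceptional points is not negligible. The
    hypothesis on the dimensions gives, around almost every point, the bounds
    r^3 <= mu (B(x, r)) <= r^(4/5) at all small scales; let G be a set of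
    points where they hold below a common scale, chosen so that it meets the
    exceptional points in a set that is not negligible, and T its closure.

    Thin annuli around far apart centres hardly meet. Two annuli with radii at
    most s <= 1 and widths at most s^30, whose centres are at distance at least
    s^10, intersect in at most two pieces of diameter of order s^10
    ([annuli_meet]): the distances to the two centres determine the two
    coordinates of a point, up to a reflection. Where mu is controlled, that is
    on T, each piece has mass at most of order s^8 ([annuli_meet_measure]).

    Hence few centres are possible. Many exceptional points have a radius in
    the same dyadic range (s/2, s] ([heavy_piece]), and they cannot be covered
    by few balls of radius s^10, of mass at most of order s^8, so that one can
    choose of order s^-3 of them at mutual distances larger than s^10
    ([separated_family]). Their annuli have mass at least of order s^3 each and
    pairwise intersections of mass at most of order s^8: by inclusion-exclusion
    ([bonferroni]) their total mass would exceed 1 ([thin_annuli_negligible]).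

    This needs the annuli to keep their mass inside T, where the small pieces
    are controlled. It holds around almost every point of G, because almost
    every point of a closed set is a density point of it
    ([density_negligible]), a fact that rests on the Besicovitch covering
    theorem ([besicovitch_covering]) since mu need not be doubling.

    The exceptional set need not be Borel, and neither need the sets selected
    from it, so sizes are measured with the outer measure [mu^*]. *)

(** * Euclidean geometry of the plane *)

Lemma norm2_ge0 {R : realType} (v : R * R) : 0 <= norm2 v.
Proof. exact: sqrtr_ge0. Qed.

Lemma norm2_sqr {R : realType} (v : R * R) :
  norm2 v ^+ 2 = v.1 ^+ 2 + v.2 ^+ 2.
Proof. by rewrite sqr_sqrtr// addr_ge0// sqr_ge0. Qed.

Lemma norm2_le {R : realType} (v : R * R) (r : R) : 0 <= r ->
  (norm2 v <= r) = (v.1 ^+ 2 + v.2 ^+ 2 <= r ^+ 2).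
Proof. by move=> r0; rewrite -norm2_sqr ler_sqr// ?nnegrE ?norm2_ge0. Qed.

Lemma norm2_opp {R : realType} (v : R * R) : norm2 (- v) = norm2 v.
Proof. by rewrite /norm2 /= !sqrrN. Qed.

Lemma norm2_distC {R : realType} (x y : R * R) : norm2 (x - y) = norm2 (y - x).
Proof. by rewrite -norm2_opp opprB. Qed.

Lemma cauchy_schwarz2 {R : realType} (u v : R * R) :
  `|u.1 * v.1 + u.2 * v.2| <= norm2 u * norm2 v.
Proof.
rewrite -ler_sqr ?nnegrE ?mulr_ge0 ?norm2_ge0// real_normK ?num_real//.
rewrite exprMn !norm2_sqr.
have := sqr_ge0 (u.1 * v.2 - u.2 * v.1); nra.
Qed.

Lemma norm2_triangle {R : realType} (x y z : R * R) :
  norm2 (x - z) <= norm2 (x - y) + norm2 (y - z).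
Proof.
have hxy := norm2_ge0 (x - y); have hyz := norm2_ge0 (y - z).
rewrite norm2_le ?addr_ge0//.
have := le_trans (ler_norm _) (cauchy_schwarz2 (x - y) (y - z)).
have := norm2_sqr (x - y); have := norm2_sqr (y - z).
rewrite /=; nra.
Qed.

Lemma le_cball2 {R : realType} (x y : R * R) (r s : R) :
  norm2 (x - y) + s <= r -> cball2 y s `<=` cball2 x r.
Proof.
move=> h z /= hz; apply: le_trans h.
by apply: (le_trans (norm2_triangle x y z)); rewrite lerD2l.
Qed.

(** The cross product tells on which side of a line a point lies. *)
Definition cross {R : realType} (u v : R * R) : R := u.1 * v.2 - u.2 * v.1.

(** Write u = y - x, e = x' - x. The numbers |u|^2 and |u - e|^2, hence u.e,
    are known up to O(w); then (u x e)^2 = |u|^2 |e|^2 - (u.e)^2 is known up to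
    O(w |e|^2 / d), and the sign of u x e, which is the same for y and z,
    determines u x e with an error the square root of that. *)
Lemma annuli_meet {R : realType} (x x' y z : R * R) (r r' w d rho : R) :
  r <= 1 -> r' <= 1 -> 0 < w -> w <= d -> d <= 1 ->
  0 <= rho -> 10 * w <= d * rho ^+ 2 -> d <= norm2 (x - x') ->
  r - w < norm2 (x - y) <= r -> r - w < norm2 (x - z) <= r ->
  r' - w < norm2 (x' - y) <= r' -> r' - w < norm2 (x' - z) <= r' ->
  0 <= cross (y - x) (x' - x) * cross (z - x) (x' - x) ->
  cball2 y rho z.
Proof.
move=> r1 r'1 w0 wd d1 rho0 hrho hD /andP[xy1 xy2] /andP[xz1 xz2].
move=> /andP[x'y1 x'y2] /andP[x'z1 x'z2].
set D := norm2 (x - x') in hD *.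
have D2 : D ^+ 2 = (x - x').1 ^+ 2 + (x - x').2 ^+ 2 := norm2_sqr _.
have near_sq (t : R) (a b : R) : t <= 1 -> 0 <= a -> 0 <= b ->
    t - w < a <= t -> t - w < b <= t -> `|a ^+ 2 - b ^+ 2| <= 2 * w.
  move=> t1 a0 b0 /andP[a1 a2] /andP[b1 b2].
  by rewrite ler_norml; apply/andP; split; nra.
have n0 := @norm2_ge0 R.
have := near_sq r _ _ r1 (n0 (x - y)) (n0 (x - z)).
rewrite xy1 xy2 xz1 xz2 => /(_ isT isT).
have := near_sq r' _ _ r'1 (n0 (x' - y)) (n0 (x' - z)).
rewrite x'y1 x'y2 x'z1 x'z2 => /(_ isT isT).
rewrite !norm2_sqr => hq' hq.
have hS1 := cauchy_schwarz2 (y - x) (x' - x).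
have hS2 := cauchy_schwarz2 (z - x) (x' - x).
have eD : norm2 (x' - x) = D by rewrite norm2_distC.
rewrite eD in hS1 hS2.
have {}hS1 : `|(y - x).1 * (x' - x).1 + (y - x).2 * (x' - x).2| <= D.
  apply: (le_trans hS1); rewrite norm2_distC ler_piMl ?n0//; exact: le_trans r1.
have {}hS2 : `|(z - x).1 * (x' - x).1 + (z - x).2 * (x' - x).2| <= D.
  apply: (le_trans hS2); rewrite norm2_distC ler_piMl ?n0//; exact: le_trans r1.
rewrite /cross /cball2 /= norm2_le//=.
move: hq hq' hS1 hS2 D2 => /=; clearbody D; clear -w0 wd d1 rho0 hrho hD.
case: x => x1 x2; case: x' => x1' x2'; case: y => y1 y2; case: z => z1 z2 /=.
(* Everything is expressed with u = (a, b), u0 = (a0, b0) and e = (e, f). *)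
have -> : x1 - y1 = - (y1 - x1) by ring.
have -> : x2 - y2 = - (y2 - x2) by ring.
have -> : x1 - z1 = - (z1 - x1) by ring.
have -> : x2 - z2 = - (z2 - x2) by ring.
have -> : x1' - y1 = (x1' - x1) - (y1 - x1) by ring.
have -> : x2' - y2 = (x2' - x2) - (y2 - x2) by ring.
have -> : x1' - z1 = (x1' - x1) - (z1 - x1) by ring.
have -> : x2' - z2 = (x2' - x2) - (z2 - x2) by ring.
have -> : y1 - z1 = (y1 - x1) - (z1 - x1) by ring.
have -> : y2 - z2 = (y2 - x2) - (z2 - x2) by ring.
have -> : x1 - x1' = - (x1' - x1) by ring.
have -> : x2 - x2' = - (x2' - x2) by ring.
move: (y1 - x1) (y2 - x2) (z1 - x1) (z2 - x2) (x1' - x1) (x2' - x2).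
move=> a b a0 b0 e f; clear x1 x2 x1' x2' y1 y2 z1 z2.
rewrite !sqrrN => hq hq' hS1 hS2 D2 hc.
(* T is small because |u|^2 and |u - e|^2 are almost known; p^2 - p0^2 is then
   controlled by q and T S, which bounds p - p0 as p and p0 have the same sign. *)
pose T := (a - a0) * e + (b - b0) * f.
pose S := (a + a0) * e + (b + b0) * f.
pose p := a * f - b * e.
pose p0 := a0 * f - b0 * e.
pose q := a ^+ 2 + b ^+ 2 - (a0 ^+ 2 + b0 ^+ 2).
have hT : `|T| <= 2 * w.
  have -> : T = 2^-1 * ((a ^+ 2 + b ^+ 2 - (a0 ^+ 2 + b0 ^+ 2)) -
    ((e - a) ^+ 2 + (f - b) ^+ 2 - ((e - a0) ^+ 2 + (f - b0) ^+ 2))).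
    by rewrite /T; field.
  rewrite normrM ger0_norm ?invr_ge0 ?ler0n//.
  have := ler_normB (a ^+ 2 + b ^+ 2 - (a0 ^+ 2 + b0 ^+ 2))
    ((e - a) ^+ 2 + (f - b) ^+ 2 - ((e - a0) ^+ 2 + (f - b0) ^+ 2)).
  lra.
have hS : `|S| <= 2 * D.
  have -> : S = (a * e + b * f) + (a0 * e + b0 * f) by rewrite /S; ring.
  by apply: (le_trans (ler_normD _ _)); lra.
have hTS : `|T * S| <= 4 * (w * D).
  by rewrite normrM; apply: (le_trans (ler_pM _ _ hT hS)) => //; lra.
have hq0 : `|q| <= 2 * w by [].
have hqD : `|q * D ^+ 2| <= 2 * w * D ^+ 2.
  by rewrite normrM (ger0_norm (sqr_ge0 D)) ler_wpM2r ?sqr_ge0.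
have eP : p ^+ 2 - p0 ^+ 2 = q * D ^+ 2 - T * S.
  by rewrite /p /p0 /q /T /S D2; ring.
have hP : (p - p0) ^+ 2 <= `|p ^+ 2 - p0 ^+ 2|.
  rewrite subr_sqr normrM -[X in X <= _]real_normK ?num_real// expr2.
  rewrite ler_wpM2l// -ler_sqr ?nnegrE// !real_normK ?num_real//.
  have hpp : 0 <= p * p0 by [].
  rewrite -subr_ge0; have -> : (p + p0) ^+ 2 - (p - p0) ^+ 2 = 4 * (p * p0) by ring.
  by rewrite mulr_ge0.
have {}hP : (p - p0) ^+ 2 <= 2 * w * D ^+ 2 + 4 * (w * D).
  apply: (le_trans hP); rewrite eP; apply: (le_trans (ler_normB _ _)).
  by lra.
have hT2 : T ^+ 2 <= 4 * w ^+ 2.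
  have -> : T ^+ 2 = `|T| ^+ 2 by rewrite real_normK ?num_real.
  have -> : 4 * w ^+ 2 = (2 * w) ^+ 2 by ring.
  by rewrite ler_sqr ?nnegrE//; lra.
have hid : ((a - a0) ^+ 2 + (b - b0) ^+ 2) * D ^+ 2 = T ^+ 2 + (p - p0) ^+ 2.
  by rewrite D2 /T /p /p0; ring.
have D0 : 0 < D ^+ 2 by apply: exprn_gt0; lra.
have d0 : 0 < d by lra.
have h : d * (((a - a0) ^+ 2 + (b - b0) ^+ 2) * D ^+ 2) <= 10 * w * D ^+ 2.
  rewrite hid.
  have : d * (T ^+ 2 + (p - p0) ^+ 2) <=
      d * (4 * w ^+ 2 + (2 * w * D ^+ 2 + 4 * (w * D))).
    by rewrite ler_wpM2l ?(ltW d0)//; lra.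
  move=> /le_trans; apply.
  have h1 : d * w <= D ^+ 2 by nra.
  have h2 : d * D <= D ^+ 2 by nra.
  have h3 : d * D ^+ 2 <= D ^+ 2 by nra.
  have h1' := ler_wpM2l (ltW w0) h1.
  have h2' := ler_wpM2l (ltW w0) h2.
  have h3' := ler_wpM2l (ltW w0) h3.
  lra.
rewrite -(ler_pM2l d0); apply: le_trans hrho.
rewrite -(ler_pM2r D0); lra.
Qed.

(** The octant of the plane that contains a vector; any division into sectors
    of angle at most 60 degrees would serve, this one needs no trigonometry. *)
Definition octant {R : realType} (v : R * R) : bool * bool * bool :=
  (0 <= v.1, 0 <= v.2, `|v.2| <= `|v.1|).

(** In a triangle, the side opposite to an angle of at most 60 degrees is not
    the longest one. *)
Lemma octant_close {R : realType} (u v : R * R) (r : R) :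
  octant u = octant v -> norm2 u <= r -> norm2 v <= r ->
  norm2 (u - v) <= r.
Proof.
case: u v => a b [c e] /=; rewrite /octant /= => -[ha hb hab] hu.
have r0 : 0 <= r := le_trans (norm2_ge0 _) hu.
move: hu; rewrite !norm2_le//= => hu hv.
move: ha hb hab.
case: (lerP 0 a) => [a0|/ltW a0] /esym; [move=> c0 | move=> /negbT; rewrite -ltNge => /ltW c0];
(case: (lerP 0 b) => [b0|/ltW b0] /esym; [move=> e0 | move=> /negbT; rewrite -ltNge => /ltW e0]);
rewrite ?(ger0_norm a0) ?(ler0_norm a0) ?(ger0_norm b0) ?(ler0_norm b0)
  ?(ger0_norm c0) ?(ler0_norm c0) ?(ger0_norm e0) ?(ler0_norm e0);
(case: lerP => [h1|/ltW h1] /esym; [move=> h2 | move=> /negbT; rewrite -ltNge => /ltW h2]).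
- have [h|/ltW h] := lerP c a; nra.
- have [h|/ltW h] := lerP e b; nra.
- have [h|/ltW h] := lerP c a; nra.
- have [h|/ltW h] := lerP e b; nra.
- have [h|/ltW h] := lerP c a; nra.
- have [h|/ltW h] := lerP e b; nra.
- have [h|/ltW h] := lerP c a; nra.
- have [h|/ltW h] := lerP e b; nra.
Qed.

(** * Dyadic grids and measurability *)

(** The square of side 2^-(k+2) that contains x in the dyadic grid. *)
Definition cell {R : realType} (k : nat) (x : R * R) : int * int :=
  (Num.floor (x.1 / 2^-1 ^+ k.+2), Num.floor (x.2 / 2^-1 ^+ k.+2)).

Lemma half_exp_gt0 {R : realType} k : 0 < (2^-1 : R) ^+ k.
Proof. by rewrite exprn_gt0// invr_gt0. Qed.

Lemma half_exp_le {R : realType} m n : (m <= n)%N -> (2^-1 : R) ^+ n <= 2^-1 ^+ m.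
Proof. by move=> mn; apply: ler_wiXn2l; [lra|lra|]. Qed.

Lemma floor_close {R : realType} (a b h : R) : 0 < h ->
  Num.floor (a / h) = Num.floor (b / h) -> `|a - b| < h.
Proof.
move=> h0 e; have := floor_itv (a / h); have := floor_itv (b / h).
rewrite -e intrD => /andP[b1 b2] /andP[a1 a2].
have : `|a / h - b / h| < 1 by rewrite ltr_norml; apply/andP; split; lra.
by rewrite -mulrBl normrM normfV (gtr0_norm h0) ltr_pdivrMr// mul1r.
Qed.

Lemma cell_close {R : realType} k (x y : R * R) : cell k x = cell k y ->
  `|x.1 - y.1| < 2^-1 ^+ k.+2 /\ `|x.2 - y.2| < 2^-1 ^+ k.+2.
Proof. by case=> e1 e2; split; apply: floor_close => //; exact: half_exp_gt0. Qed.

Lemma cell_dist {R : realType} k (x y : R * R) : cell k x = cell k y ->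
  norm2 (x - y) <= 2^-1 ^+ k.+1.
Proof.
move=> /cell_close[h1 h2]; have := half_exp_gt0 (R := R) k.+2.
have -> : (2^-1 : R) ^+ k.+1 = 2 * 2^-1 ^+ k.+2 by rewrite [in RHS]exprS; field.
move: h1 h2; move: (2^-1 ^+ k.+2) => h h1 h2 h0.
rewrite norm2_le ?mulr_ge0 ?(ltW h0)//=.
by move: h1 h2; rewrite !ltr_norml => /andP[? ?] /andP[? ?]; nra.
Qed.

(** Colouring the cells by their coordinates modulo 16 keeps two distinct cells
    of the same colour further apart than the balls of that scale can reach. *)
Definition residue (n : int) : 'I_16 := inord `|(n %% 16)%Z|%N.

Lemma residue_far (a b : int) : residue a = residue b -> a != b ->
  16 <= `|a - b|.
Proof.
move=> /(congr1 val) /=.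
have lt16 (n : int) : (`|(n %% 16)%Z| < 16)%N.
  by rewrite -ltz_nat gez0_abs ?modz_ge0// ltz_pmod.
rewrite !inordK ?lt16// => e ab.
have {}e : (a %% 16)%Z = (b %% 16)%Z.
  by rewrite -[LHS]gez0_abs ?modz_ge0// -[RHS]gez0_abs ?modz_ge0// e.
have : (16 %| a - b)%Z by rewrite -eqz_mod_dvd e.
move=> /dvdzP[q hq]; rewrite hq normrM.
have q0 : q != 0 by apply: contra_neq ab => q0; apply/eqP; rewrite -subr_eq0 hq q0 mul0r.
by rewrite ler_peMl// -gtz0_ge1 normr_gt0.
Qed.

Lemma floor_far {R : realType} (a b h : R) : 0 < h ->
  16 <= `|Num.floor (a / h) - Num.floor (b / h)| -> 15 * h < `|a - b|.
Proof.
move=> h0 e; have := floor_itv (a / h); have := floor_itv (b / h).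
rewrite !intrD => /andP[b1 b2] /andP[a1 a2].
have : 15 < `|a / h - b / h|.
  move: e; rewrite ler_normr ltr_normr => /orP[]; rewrite -(ler_int R) => e.
  - by apply/orP; left; move: e; rewrite intrB; lra.
  - by apply/orP; right; move: e; rewrite opprB intrB; lra.
by rewrite -mulrBl normrM normfV (gtr0_norm h0) ltr_pdivlMr.
Qed.

Lemma cell_far {R : realType} k (x y : R * R) : cell k x != cell k y ->
  residue (cell k x).1 = residue (cell k y).1 ->
  residue (cell k x).2 = residue (cell k y).2 ->
  2 * 2^-1 ^+ k < norm2 (x - y).
Proof.
move=> hne e1 e2; rewrite ltNge; apply/negP => hle.
have h0 := half_exp_gt0 (R := R) k.+2.
have ek : (2^-1 : R) ^+ k = 4 * 2^-1 ^+ k.+2 by rewrite 2![in RHS]exprS; field.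
have hcoord (a : R) : a ^+ 2 <= norm2 (x - y) ^+ 2 -> `|a| <= 8 * 2^-1 ^+ k.+2.
  move=> ha; apply: (@le_trans _ _ (norm2 (x - y))).
    by rewrite -ler_sqr ?nnegrE ?norm2_ge0// real_normK ?num_real.
  by move: hle; rewrite ek; lra.
have h1 : `|x.1 - y.1| <= 8 * 2^-1 ^+ k.+2.
  by apply: hcoord; rewrite norm2_sqr /= lerDl sqr_ge0.
have h2 : `|x.2 - y.2| <= 8 * 2^-1 ^+ k.+2.
  by apply: hcoord; rewrite norm2_sqr /= lerDr sqr_ge0.
move: hne; rewrite -pair_eqE negb_and => /orP[/residue_far|/residue_far].
- by move=> /(_ e1) /(floor_far _ _ _ h0); lra.
- by move=> /(_ e2) /(floor_far _ _ _ h0); lra.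
Qed.

Lemma measurable_le {R : realType} d (T : measurableType d) (f g : T -> R) :
  measurable_fun setT f -> measurable_fun setT g ->
  measurable [set y | f y <= g y].
Proof.
move=> mf mg.
by rewrite -[X in measurable X]setTI; exact: measurable_fun_le.
Qed.

Lemma measurable_cell {R : realType} k (c : int * int) :
  measurable ([set y | cell k y = c] : set (plane R)).
Proof.
have -> : [set y : plane R | cell k y = c] =
    (fst @^-1` [set t | Num.floor (t / 2^-1 ^+ k.+2) = c.1]) `&`
    (snd @^-1` [set t | Num.floor (t / 2^-1 ^+ k.+2) = c.2]).
  apply/seteqP; split => y /=; first by move=> <-.
  by case: c => c1 c2 /= [<- <-].
have mc (n : int) :
    measurable ([set t | Num.floor (t / 2^-1 ^+ k.+2) = n] : set (measurableTypeR R)).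
  have -> : [set t | Num.floor (t / 2^-1 ^+ k.+2) = n] =
      `[n%:~R * (2^-1 : R) ^+ k.+2, (n + 1)%:~R * 2^-1 ^+ k.+2[%classic.
    apply/seteqP; split => t /=; rewrite in_itv/= -ler_pdivlMr ?half_exp_gt0//
      -ltr_pdivrMr ?half_exp_gt0// -floor_eq; by move/eqP.
  exact: measurable_itv.
apply: measurableI; rewrite -[X in measurable X]setTI.
- exact: measurable_fst.
- exact: measurable_snd.
Qed.

Lemma exists_half_exp_lt {R : realType} (e : R) : 0 < e -> exists k, 2^-1 ^+ k < e.
Proof.
move=> e0; have : (2^-1 : R) ^+ n @[n --> \oo] --> 0.
  by apply: cvg_expr; rewrite ger0_norm ?invr_ge0// invf_lt1// ltr1n.
move=> /cvgrPdist_lt /(_ _ e0)[k _ /(_ k (leqnn k))].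
by rewrite /= sub0r normrN ger0_norm ?exprn_ge0 ?invr_ge0//; exists k.
Qed.

(** An open set is the union of the countably many grid cells inside it. *)
Lemma open_measurable_plane {R : realType} (U : set (R * R)) :
  open U -> measurable (U : set (plane R)).
Proof.
move=> oU.
pose F (i : nat * (int * int)) : set (plane R) :=
  if `[< [set y : R * R | cell i.1 y = i.2] `<=` U >]
  then [set y | cell i.1 y = i.2] else set0.
have -> : U = \bigcup_i F i.
  apply/seteqP; split => [x Ux|x [i _]]; last first.
    by rewrite /F; case: asboolP => // h /h.
  have /nbhs_ballP[e /= e0 he] : nbhs x U by exact: open_nbhs_nbhs.
  have [k hk] := exists_half_exp_lt e e0.
  have hk2 : (2^-1 : R) ^+ k.+2 < e.
    exact: le_lt_trans (half_exp_le _ _ (leq_trans (leqnSn k) (leqnSn _))) hk.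
  exists (k, cell k x) => //; rewrite /F asboolT//= => y /= /cell_close[h1 h2].
  by apply: he; split; rewrite /ball /= distrC; exact: lt_trans hk2.
apply: countable_bigcupT_measurable => [|i]; first exact: countableP.
by rewrite /F; case: asboolP => _; [exact: measurable_cell|exact: measurable0].
Qed.

Lemma measurable_cball2 {R : realType} (x : R * R) (r : R) :
  measurable (cball2 x r : set (plane R)).
Proof.
have [r0|r0] := lerP 0 r; last first.
  have -> : cball2 x r = set0; last exact: measurable0.
  apply/seteqP; split => // y /= h.
  by have := le_lt_trans (le_trans (norm2_ge0 _) h) r0; rewrite ltxx.
have -> : cball2 x r =
    [set y : plane R | (x.1 - y.1) ^+ 2 + (x.2 - y.2) ^+ 2 <= r ^+ 2].
  by apply/seteqP; split => y /=; rewrite /cball2 /= norm2_le.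
apply: measurable_le => //.
apply: measurable_funD; apply: measurable_funX; apply: measurable_funB => //.
Qed.

Lemma measurable_octant {R : realType} (x : R * R) (o : bool * bool * bool) :
  measurable ([set y | octant (x - y) = o] : set (plane R)).
Proof.
have mpred (b : bool) (p : plane R -> bool) :
    measurable [set y | p y] -> measurable [set y | p y = b].
  move=> mp; case: b => //.
  have -> : [set y | p y = false] = ~` [set y | p y].
    by apply/seteqP; split => y /=; [move=> -> | move/negP/negbTE].
  exact: measurableC.
have -> : [set y : plane R | octant (x - y) = o] =
    [set y | (0 <= x.1 - y.1) = o.1.1] `&` [set y | (0 <= x.2 - y.2) = o.1.2] `&`
    [set y | (`|x.2 - y.2| <= `|x.1 - y.1|) = o.2].
  apply/seteqP; split => y /=; rewrite /octant /=; first by move=> <-.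
  by case: o => [[? ?] ?] /= [[<- <-] <-].
have m1 : measurable_fun setT (fun y : plane R => x.1 - y.1).
  by apply: measurable_funB.
have m2 : measurable_fun setT (fun y : plane R => x.2 - y.2).
  by apply: measurable_funB.
apply: measurableI; [apply: measurableI|].
- by apply: mpred; apply: (measurable_le _ (plane R) (cst 0) (fun y : plane R => x.1 - y.1)).
- by apply: mpred; apply: (measurable_le _ (plane R) (cst 0) (fun y : plane R => x.2 - y.2)).
- apply: mpred; apply: (measurable_le _ (plane R) (fun y : plane R => `|x.2 - y.2|)
    (fun y : plane R => `|x.1 - y.1|)); exact: measurableT_comp.
Qed.

(** * Covering by balls of bounded overlap *)

Local Open Scope ereal_scope.

(** If the sets containing a given point carry distinct codes below m, no point
    lies in more than m of them, whence the bound. Cutting the sets according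
    to the code gives m disjoint families, so that additivity suffices. *)
Lemma nneseries_bounded_overlap d (T : measurableType d) (R : realType)
    (mu : {measure set T -> \bar R}) (B : (set T)^nat) (W : set T)
    (m : nat) (code : nat -> T -> nat) :
  (forall n, measurable (B n)) -> measurable W -> (forall n, B n `<=` W) ->
  (forall n k, measurable [set y | code n y = k]) ->
  (forall n y, (code n y < m)%N) ->
  (forall n n' y, B n y -> B n' y -> code n y = code n' y -> n = n') ->
  \sum_(n <oo) mu (B n) <= m%:R%:E * mu W.
Proof.
move=> mB mW BW mcode ltcode inj.
pose piece k n := B n `&` [set y | code n y = k].
have mpiece k n : measurable (piece k n) by exact: measurableI.
have split_code n : mu (B n) <= \sum_(0 <= k < m) mu (piece k n).
  rewrite big_mkord; apply: (@content_subadditive _ _ _ mu _ (piece^~ n) m) => //.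
  rewrite -(bigcup_mkord m (piece^~ n)) => y By; exists (code n y) => //=; exact: ltcode.
apply: (@le_trans _ _ (\sum_(n <oo) \sum_(0 <= k < m) mu (piece k n))).
  by apply: lee_nneseries => // n _; exact: measure_ge0.
rewrite (@nneseries_sum_nat _ _ _ (fun k n => mu (piece k n)))//.
have -> : m%:R%:E * mu W = \sum_(0 <= k < m) mu W.
  by rewrite sumr_const_nat subn0 mule_natl.
have triv k : trivIset setT (piece k).
  apply/trivIsetP => i j _ _ ij; apply/seteqP; split => // y [[Bi /= ci] [Bj /= cj]].
  by move/eqP: ij; apply; apply: (inj _ _ y) => //; rewrite ci cj.
apply: lee_sum => k _.
have mU : measurable (\bigcup_n piece k n) by apply: bigcupT_measurable => n; exact: mpiece.
rewrite -(measure_semi_bigcup mu (mpiece k) (triv k) mU).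
by apply: le_measure; rewrite ?inE// => y [n _ [/BW]].
Qed.

Local Close Scope ereal_scope.

Lemma dyadic_scale {R : realType} (r : R) : 0 < r <= 1 ->
  exists k, 2^-1 ^+ k.+1 < r <= 2^-1 ^+ k.
Proof.
move=> /andP[r0 r1].
have [k0 hk0] := exists_half_exp_lt r r0.
have ex : exists k, (2^-1 : R) ^+ k.+1 < r.
  exists k0; apply: le_lt_trans hk0.
  exact/half_exp_le/leqnSn.
case: (ex_minnP ex) => k hk kmin; exists k; rewrite hk /=.
case: k hk kmin => [|k] hk kmin; first by rewrite expr0.
by rewrite leNgt; apply/negP => /kmin; rewrite ltnn.
Qed.

(** Besicovitch covering theorem for the plane, in the form of a colouring: the
    balls of the cover that contain a point y are told apart by the octant in
    which y sees their centre and by their colour, so that their number is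
    bounded.

    The balls are selected by decreasing dyadic scales; at each scale one point
    is picked in each grid cell that contains points not covered before. Two
    balls of different scales containing y have centres in different octants
    around y, or else the centre of the smaller would have been covered by the
    larger ([octant_close]). At equal scales, centres of the same colour are
    too far apart for the balls to meet ([cell_far]). *)
Lemma besicovitch_covering {R : realType} (D : set (R * R)) (rho : R * R -> R) :
  (forall x, D x -> 0 < rho x <= 1) ->
  exists (V : set nat) (c : nat -> R * R) (color : nat -> 'I_16 * 'I_16),
  [/\ forall n, V n -> D (c n),
      D `<=` \bigcup_(n in V) cball2 (c n) (rho (c n)) &
      forall n n' y, V n -> V n' ->
        cball2 (c n) (rho (c n)) y -> cball2 (c n') (rho (c n')) y ->
        octant (c n - y) = octant (c n' - y) -> color n = color n' -> n = n'].
Proof.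
move=> rho01.
have [scale scaleP] : {scale : R * R -> nat & forall x, D x ->
    2^-1 ^+ (scale x).+1 < rho x <= 2^-1 ^+ scale x}.
  apply: (@choice _ _ (fun x k => D x -> 2^-1 ^+ k.+1 < rho x <= 2^-1 ^+ k)) => x.
  have [Dx|nDx] := pselect (D x); last by exists 0%N.
  by have [k hk] := dyadic_scale _ (rho01 x Dx); exists k.
(* Points of the scale k and the cell c that [cov] leaves uncovered. *)
pose rest cov k c := [set x | [/\ D x, scale x = k, cell k x = c & ~ cov x]].
pose pick cov k c : R * R := xget (0, 0) (rest cov k c).
(* What the balls of the scales before k cover. *)
pose fix cov k : set (R * R) := if k is k'.+1 then
  cov k' `|` \bigcup_(c in [set c | rest (cov k') k' c !=set0])
    cball2 (pick (cov k') k' c) (rho (pick (cov k') k' c))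
  else set0.
pose sel (i : nat * (int * int)) := pick (cov i.1) i.1 i.2.
pose valid (i : nat * (int * int)) := rest (cov i.1) i.1 i.2 !=set0.
have selP i : valid i -> rest (cov i.1) i.1 i.2 (sel i).
  by move=> [x hx]; apply: xgetPex; exists x.
have cov_le j k : (j <= k)%N -> cov j `<=` cov k.
  elim: k => [|k ih]; first by rewrite leqn0 => /eqP ->.
  rewrite leq_eqVlt => /orP[/eqP -> //|]; rewrite ltnS => /ih h y /h hy.
  by left.
have sel_cov i k : valid i -> (i.1 < k)%N ->
    cball2 (sel i) (rho (sel i)) `<=` cov k.
  move=> vi ik; apply: subset_trans (cov_le _ _ ik).
  by move=> y hy; right; exists i.2.
have sel_inj i j y : valid i -> valid j ->
    cball2 (sel i) (rho (sel i)) y -> cball2 (sel j) (rho (sel j)) y ->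
    octant (sel i - y) = octant (sel j - y) -> (i.1 < j.1)%N -> False.
  move=> vi vj yi yj oij ij.
  have [Di si ci nci] := selP i vi; have [Dj sj cj ncj] := selP j vj.
  apply: ncj; apply: (sel_cov i) => //; rewrite /cball2 /=.
  have -> : sel i - sel j = (sel i - y) - (sel j - y).
    by rewrite opprB addrA subrK.
  apply: octant_close => //; apply: (le_trans yj).
  have /andP[_ hj] := scaleP _ Dj; have /andP[/ltW hi _] := scaleP _ Di.
  apply: (le_trans hj); apply: le_trans hi; rewrite si sj.
  exact: half_exp_le.
pose valid_nat := [set n | exists2 i, n = pickle i & valid i].
pose idx n : nat * (int * int) := odflt (0%N, (0, 0)) (unpickle n).
exists valid_nat, (fun n => sel (idx n)),
  (fun n => (residue (idx n).2.1, residue (idx n).2.2)); split.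
- move=> _ [i -> vi]; rewrite /idx pickleK /=; by have [] := selP i vi.
- move=> x Dx.
  have [hx|hx] := pselect (cov (scale x) x).
    suff : forall k, cov k x -> (\bigcup_(n in valid_nat)
      cball2 (sel (idx n)) (rho (sel (idx n)))) x by apply; exact: hx.
    elim=> // k ih [/ih //|[c vc hc]].
    exists (pickle (k, c)); first by exists (k, c).
    by rewrite /idx pickleK.
  have v : valid (scale x, cell (scale x) x) by exists x.
  exists (pickle (scale x, cell (scale x) x)).
    by exists (scale x, cell (scale x) x).
  rewrite /idx pickleK /=; have [Ds ss cs _] := selP _ v; rewrite /cball2 /=.
  have /andP[/ltW hs _] := scaleP _ Ds.
  apply: le_trans hs; rewrite ss; exact: cell_dist.
- move=> _ _ y [i -> vi] [j -> vj]; rewrite /idx !pickleK /= => yi yj oij [e1 e2].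
  congr pickle.
  have [Di si ci nci] := selP i vi; have [Dj sj cj ncj] := selP j vj.
  have [ij|ji|eij] := ltngtP i.1 j.1.
  + by have := sel_inj i j y vi vj yi yj oij ij.
  + by have := sel_inj j i y vj vi yj yi (esym oij) ji.
  have /eqP e : i.2 == j.2; last by case: (i) (j) eij e => ? ? [? ?] /= -> ->.
  apply/negPn/negP => ne; move: ne e1 e2; rewrite -ci -cj eij => ne e1 e2.
  have := cell_far _ _ _ ne e1 e2; apply/negP; rewrite -leNgt.
  apply: (le_trans (norm2_triangle _ y _)).
  have /andP[_ hi] := scaleP _ Di; have /andP[_ hj] := scaleP _ Dj.
  rewrite si eij in hi; rewrite sj in hj.
  have : norm2 (y - sel j) <= rho (sel j) by rewrite norm2_distC.
  have : norm2 (sel i - y) <= rho (sel i) by [].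
  clear -hi hj; lra.
Qed.

(** * Outer measure and density points *)

Local Open Scope ereal_scope.

Lemma mu_ext_eq0_negligible d (T : measurableType d) (R : realType)
    (mu : {measure set T -> \bar R}) (A : set T) :
  (mu^*)%mu A = 0 -> mu.-negligible A.
Proof.
move=> A0.
have ex n : exists F, [/\ measurable F, A `<=` F & mu F <= (n.+1%:R^-1)%:E].
  have : (mu^*)%mu A < (n.+1%:R^-1)%:E by rewrite A0 lte_fin invr_gt0 ltr0Sn.
  move=> /ereal_inf_lt[_ [F [mF AF] <-]] hF.
  exists (\bigcup_k F k); split => //; first exact: bigcupT_measurable.
  apply: le_trans (ltW hF).
  by apply: measure_sigma_subadditive => //; exact: bigcupT_measurable.
have [F FP] := choice ex.
exists (\bigcap_n F n); split.
- by apply: bigcapT_measurable => n; have [] := FP n.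
- apply/eqP; rewrite eq_le measure_ge0 andbT.
  apply/lee_addgt0Pr => e e0; rewrite add0e.
  have [n hn] : exists n, (n.+1%:R^-1 < e)%R.
    have [N _ /(_ N (leqnn N))] := near_infty_natSinv_lt (PosNum e0).
    by exists N.
  have [mF _ hF] := FP n.
  apply: (@le_trans _ _ (mu (F n))); last by rewrite (le_trans hF)// lee_fin ltW.
  apply: le_measure; rewrite ?inE//; last exact: bigcap_inf.
  by apply: bigcapT_measurable => k; have [] := FP k.
- by apply: sub_bigcap => n _; have [] := FP n.
Qed.

Lemma mu_ext_bigcup_le d (T : measurableType d) (R : realType)
    (mu : {measure set T -> \bar R}) (A : set T) (B : (set T)^nat) :
  (forall n, measurable (B n)) -> A `<=` \bigcup_n B n ->
  (mu^*)%mu A <= \sum_(n <oo) mu (B n).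
Proof. by move=> mB AB; apply: ereal_inf_lbound; exists B. Qed.

Lemma radon_outer_approx (R : realType) (mu : probability (plane R) R)
    (T : set (plane R)) (e : R) : radon mu -> measurable T -> (0 < e)%R ->
  exists U : set (R * R), [/\ open U, T `<=` U & mu (U `\` T) <= e%:E].
Proof.
move=> [_ _ outer] mT e0.
have finT : mu T \is a fin_num by exact: fin_num_measure.
have := outer T mT => /esym eT.
have /(lb_ereal_inf_adherent e0) : ereal_inf [set mu U | U in
    [set U : set (R * R) | open U /\ T `<=` U]] \is a fin_num by rewrite eT.
rewrite eT => -[_ [U [oU TU] <-] hU]; exists U; split => //.
have mU := open_measurable_plane _ oU.
rewrite measureD//; last by rewrite ltey_eq fin_num_measure.
rewrite (setIidr TU); apply: ltW; rewrite lteBlDl//.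
Qed.

(** Almost every point of a closed set T is a density point of T. By outer
    regularity T has an open neighbourhood U with mu (U \ T) <= e; the balls
    where T lacks a proportion k of the mass can be taken inside U, and the
    covering theorem bounds the mass of their centres by a multiple of e. *)
Lemma density_negligible (R : realType) (mu : probability (plane R) R)
    (T D : set (R * R)) (k : R) :
  radon mu -> closed T -> D `<=` T -> (0 < k)%R ->
  (forall x, D x -> forall e, (0 < e)%R -> exists2 r, (0 < r < e)%R &
    k%:E * mu (cball2 x r) <= mu (cball2 x r `\` T)) ->
  mu.-negligible D.
Proof.
move=> hradon cT DT k0 hD; apply: mu_ext_eq0_negligible.
have mT : measurable (T : set (plane R)).
  by rewrite -(setCK T); apply: measurableC; apply: open_measurable_plane; exact: closed_openC.
pose m := #|{: (bool * bool * bool) * ('I_16 * 'I_16)}|.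
have main (e : R) : (0 < e)%R -> k%:E * (mu^*)%mu D <= (m%:R * e)%:E.
  move=> e0; have [U [oU TU mUT]] := radon_outer_approx _ _ _ _ hradon mT e0.
  have [rho rhoP] : {rho : R * R -> R & forall x, D x ->
      [/\ (0 < rho x <= 1)%R, cball2 x (rho x) `<=` U &
        k%:E * mu (cball2 x (rho x)) <= mu (cball2 x (rho x) `\` T)]}.
    apply: (@choice _ _ (fun x s => D x -> [/\ (0 < s <= 1)%R, cball2 x s `<=` U &
        k%:E * mu (cball2 x s) <= mu (cball2 x s `\` T)])) => x.
    have [Dx|nDx] := pselect (D x); last by exists 0%R.
    have /nbhs_ballP[s /= s0 hs] : nbhs (x : R * R) U.
      by apply: open_nbhs_nbhs; split => //; apply: TU; exact: DT.
    have min0 : (0 < Num.min s 1)%R by rewrite lt_min s0 ltr01.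
    have [r /andP[r0 rmin] hr] := hD _ Dx _ min0.
    move: rmin; rewrite lt_min => /andP[rs r1].
    exists r => _; split => //; first by rewrite r0 ltW.
    move=> y; rewrite /cball2 /= norm2_le ?(ltW r0)//= => hy.
    by apply: hs; split; rewrite /ball /=; apply: le_lt_trans rs;
      rewrite -ler_sqr ?nnegrE ?(ltW r0)// real_normK ?num_real//; apply: le_trans hy;
      rewrite ?lerDl ?lerDr sqr_ge0.
  have [V [c [color [VD cover inj]]]] :=
    besicovitch_covering D rho (fun x Dx => let: And3 h _ _ := rhoP x Dx in h).
  pose B n : set (plane R) := if `[< V n >] then cball2 (c n) (rho (c n)) else set0.
  have mB n : measurable (B n).
    by rewrite /B; case: asboolP => _; [exact: measurable_cball2|exact: measurable0].
  have DB : D `<=` \bigcup_n B n.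
    by move=> x /cover[n Vn hx]; exists n => //; rewrite /B asboolT.
  have step n : k%:E * mu (B n) <= mu (B n `\` T).
    rewrite /B; case: asboolP => [Vn|_].
      by have [] := rhoP _ (VD _ Vn).
    by rewrite set0D measure0 mule0.
  (* The position of the octant and the colour in an enumeration, since codes
     are natural numbers. *)
  pose code n (y : R * R) : nat := enum_rank (octant (c n - y)%R, color n).
  have overlap : \sum_(n <oo) mu (B n `\` T) <= m%:R%:E * mu (U `\` T).
    apply: (@nneseries_bounded_overlap _ _ _ mu (fun n => B n `\` T) _ m code).
    - by move=> n; exact: measurableD.
    - by apply: measurableD => //; exact: open_measurable_plane.
    - move=> n; apply: setSD; rewrite /B; case: asboolP => [Vn|_]; last exact: sub0set.
      by have [] := rhoP _ (VD _ Vn).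
    - move=> n j; have [jm|mj] := ltnP j m; last first.
        have -> : [set y : plane R | code n y = j] = set0; last exact: measurable0.
        apply/seteqP; split => // y /= hy.
        by move: mj; rewrite -hy leqNgt ltn_ord.
      case E: (enum_val (Ordinal jm)) => [oc cl].
      have [ecl|ncl] := eqVneq cl (color n); last first.
        have -> : [set y : plane R | code n y = j] = set0; last exact: measurable0.
        apply/seteqP; split => // y /= hy; case/eqP: ncl.
        have : enum_val (Ordinal jm) = (octant (c n - y)%R, color n).
          by rewrite -[RHS]enum_rankK; congr enum_val; apply: val_inj.
        by rewrite E => -[].
      have -> : [set y : plane R | code n y = j] = [set y | octant (c n - y)%R = oc].
        apply/seteqP; split => y /= hy.
          have : enum_val (Ordinal jm) = (octant (c n - y)%R, color n).
            by rewrite -[RHS]enum_rankK; congr enum_val; apply: val_inj.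
          by rewrite E => -[].
        by rewrite /code hy -ecl -E enum_valK.
      exact: measurable_octant.
    - by move=> n y; rewrite /code ltn_ord.
    - move=> n n' y [+ _] [+ _] /val_inj /enum_rank_inj [].
      rewrite /B; case: asboolP => // Vn hn; case: asboolP => // Vn' hn'.
      by move=> o1 o2 o3; apply: (inj _ _ y) => //; rewrite /octant /= o1 o2 o3.
  apply: (@le_trans _ _ (k%:E * \sum_(n <oo) mu (B n))).
    by apply: lee_wpmul2l; [rewrite lee_fin ltW | exact: mu_ext_bigcup_le].
  rewrite -nneseriesZl//.
  apply: (@le_trans _ _ (\sum_(n <oo) mu (B n `\` T))).
    by apply: lee_nneseries => // n _; rewrite mule_ge0// lee_fin ltW.
  apply: (le_trans overlap); rewrite EFinM.
  by apply: lee_wpmul2l; rewrite ?lee_fin ?ler0n.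
have : k%:E * (mu^*)%mu D <= 0.
  apply/lee_addgt0Pr => e e0; rewrite add0e.
  have m1 : (0 < m.+1%:R :> R)%R by [].
  apply: le_trans (main (e / m.+1%:R)%R _) _; first by rewrite divr_gt0.
  rewrite lee_fin mulrCA ler_piMr ?(ltW e0)// ler_pdivrMr// mul1r ler_nat.
  exact: leqnSn.
rewrite pmule_rle0 ?lte_fin// => h.
by apply/eqP; rewrite eq_le h mu_ext_ge0.
Qed.

(** * Counting tools *)

(** Adding the n-th set to the previous ones gains at least m and loses at
    most what it shares with them, that is n q. *)
Lemma bonferroni d (T : measurableType d) (R : realType) (mu : probability T R)
    (A : (set T)^nat) (m q : R) (n : nat) :
  (forall i, measurable (A i)) -> (forall i, (i < n)%N -> m%:E <= mu (A i)) ->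
  (forall i j, (i < j < n)%N -> mu (A i `&` A j) <= q%:E) -> (0 <= q)%R ->
  (n%:R * m <= 1 + n%:R ^+ 2 * q)%R.
Proof.
move=> mA mAi Aij q0.
suff : (n%:R * m)%:E <= mu (\big[setU/set0]_(i < n) A i) + (n%:R ^+ 2 * q)%:E.
  rewrite -lee_fin => /le_trans; apply; rewrite EFinD leeD2r//.
  by apply: probability_le1; exact: bigsetU_measurable.
elim: n mAi Aij => [|n ih] mAi Aij.
  by rewrite big_ord0 measure0 expr2 !mul0r adde0.
have {}ih := ih (fun i h => mAi i (ltnW h))
  (fun i j => fun h : (i < j < n)%N => Aij i j (let: conj a b := andP h in
    introT andP (conj a (ltnW b)))).
rewrite big_ord_recr /=; set U := \big[setU/set0]_(i < n) A i in ih *.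
have mU : measurable U by exact: bigsetU_measurable.
have hI : mu (U `&` A n) <= (n%:R * q)%:E.
  rewrite /U big_distrl /=.
  apply: (le_trans (content_subadditive (F := fun i => A i `&` A n) (n := n) mu _ _ _)) => //.
  - by move=> k _; exact: measurableI.
  - by apply: bigsetU_measurable => i _; exact: measurableI.
  apply: (@le_trans _ _ (\sum_(i < n) q%:E)).
    by apply: lee_sum => i _; apply: Aij; rewrite ltn_ord /=.
  by rewrite sumEFin lee_fin sumr_const card_ord mulr_natl.
have hA := mAi n (ltnSn n).
have eqU : mu (U `|` A n) = mu U + mu (A n) - mu (U `&` A n).
  by apply: measureUfinl => //; rewrite ltey_eq fin_num_measure.
have mUA : measurable (U `|` A n) by exact: measurableU.
have mUI : measurable (U `&` A n) by exact: measurableI.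
move: eqU hI hA ih.
rewrite -(fineK (fin_num_measure mu _ mUA)) -(fineK (fin_num_measure mu _ mU)).
rewrite -(fineK (fin_num_measure mu _ (mA n))) -(fineK (fin_num_measure mu _ mUI)).
move: (fine (mu (U `|` A n))) (fine (mu U)) (fine (mu (A n))) (fine (mu (U `&` A n))).
move=> a b c e; rewrite -EFinB -!EFinD !lee_fin => -[->].
rewrite -natr1; have : (0 <= n%:R :> R)%R by [].
move: (n%:R : R)%R => t t0 h1 h2 h3; nra.
Qed.

(** Greedy choice: fewer than N balls of radius d do not cover S, so that a
    point far from all the centres chosen before always remains. *)
Lemma separated_family (R : realType) (mu : probability (plane R) R)
    (S : set (R * R)) (d q : R) (N : nat) :
  (forall x, S x -> mu (cball2 x d) <= q%:E) -> (0 <= q)%R ->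
  (N%:R * q)%:E < (mu^*)%mu S ->
  exists f : nat -> R * R, (forall i, (i < N)%N -> S (f i)) /\
    forall i j, (i < j < N)%N -> (d < norm2 (f i - f j))%R.
Proof.
move=> Sq q0; elim: N => [|N ih] hN.
  by exists (fun=> (0, 0)%R); split => // i j; rewrite ltn0 andbF.
have /ih[f [fS fsep]] : (N%:R * q)%:E < (mu^*)%mu S.
  by apply: le_lt_trans hN; rewrite lee_fin ler_wpM2r// ler_nat.
have [x [Sx xfar]] : exists x, S x /\
    forall i, (i < N)%N -> (d < norm2 (f i - x))%R.
  apply: contrapT => /forallNP nex.
  suff : (mu^*)%mu S <= (N%:R * q)%:E.
    rewrite leNgt => /negP; apply; apply: le_lt_trans hN.
    by rewrite lee_fin ler_wpM2r// ler_nat.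
  have cover : S `<=` \big[setU/set0]_(i < N) cball2 (f i) d.
    rewrite -(bigcup_mkord N (fun i => cball2 (f i) d)) => x Sx.
    apply: contrapT => nx; apply: (nex x); split => // i iN.
    by rewrite ltNge; apply/negP => h; apply: nx; exists i.
  apply: (le_trans (le_outer_measure (mu^*)%mu _ _ cover)).
  apply: (le_trans (outer_measure_subadditive _ (fun i => cball2 (f i) d) N)).
  apply: (@le_trans _ _ (\sum_(i < N) q%:E)).
    apply: lee_sum => i _; rewrite /= measurable_mu_extE; last exact: measurable_cball2.
    by apply: Sq; exact: fS.
  by rewrite sumEFin lee_fin sumr_const card_ord mulr_natl.
exists (fun i => if (i < N)%N then f i else x); split.
- by move=> i _; case: ifPn => // /fS.
- move=> i j /andP[ij]; rewrite ltnS leq_eqVlt => /orP[/eqP jN|jN].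
    by rewrite -jN ij jN ltnn; apply: xfar; rewrite -jN.
  by rewrite jN (ltn_trans ij jN); apply: fsep; rewrite ij.
Qed.

(** Otherwise the pieces would add up to at most half of the whole. The
    geometric loss 2^-n is proportional to the radius when the pieces are
    indexed by dyadic scales. *)
Lemma heavy_piece (R : realType) (T : Type) (nu : {outer_measure set T -> \bar R})
    (S : set T) (E : (set T)^nat) :
  0 < nu S -> nu S \is a fin_num -> S `<=` \bigcup_n E n ->
  exists n, (fine (nu S) / (2 ^ n.+2)%:R)%:E < nu (E n).
Proof.
move=> S0 fS SE; apply: contrapT => /forallNP nex.
have c0 : (0 < fine (nu S))%R by rewrite fine_gt0// S0 ltey_eq fS.
have : nu S <= (fine (nu S) / 2)%:E.
  apply: (le_trans (le_outer_measure nu _ _ SE)).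
  apply: (le_trans (outer_measure_sigma_subadditive nu E)).
  apply: le_trans (epsilon_trick0 predT _); last by rewrite divr_ge0// ltW.
  apply: lee_nneseries => [n _ _|n _]; first exact: outer_measure_ge0.
  have := nex n; move/negP; rewrite -leNgt => /le_trans; apply.
  by rewrite lee_fin -mulrA -invfM -natrM -expnS.
rewrite -{1}(fineK fS) lee_fin; lra.
Qed.

Local Close Scope ereal_scope.

(** * Thin annuli around separated centres *)

Lemma annulus_shell {R : realType} (x z : R * R) (r s : R) : 0 < r <= s ->
  annulus x r 30 z -> r - s ^+ 30 < norm2 (x - z) <= r.
Proof.
move=> /andP[r0 rs] [/= hz /negP]; rewrite -ltNge powR_mulrn ?(ltW r0)// => h.
rewrite hz andbT; apply: le_lt_trans h.
by rewrite lerD2l lerN2 lerXn2r// nnegrE ltW// (lt_le_trans r0).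
Qed.

Lemma measurable_annulus {R : realType} (x : R * R) (r delta : R) :
  measurable (annulus x r delta : set (plane R)).
Proof. by apply: measurableD; exact: measurable_cball2. Qed.

(** On either side of the line through the centres, the part of the
    intersection in T lies in a single ball of radius 32 s^10 centred at a
    point of T, hence of controlled mass. The radius is written as a fifth
    power to which the bound on T applies. *)
Lemma annuli_meet_measure {R : realType} (mu : probability (plane R) R)
    (T : set (R * R)) (t0 s r r' : R) (x x' : R * R) :
  measurable (T : set (plane R)) ->
  (forall z, T z -> forall t, 0 < t < t0 ->
    (mu (cball2 z (t ^+ 5)) <= (2 * t ^+ 4)%:E)%E) ->
  0 < s <= 1 -> 2 * s ^+ 2 < t0 -> 0 < r <= s -> 0 < r' <= s ->
  s ^+ 10 <= norm2 (x - x') ->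
  (mu ((annulus x r 30 `&` T) `&` (annulus x' r' 30 `&` T)) <= (64 * s ^+ 8)%:E)%E.
Proof.
move=> mT hT /andP[s0 s1] st0 rs r's xx'.
set I := _ `&` _.
have mI : measurable (I : set (plane R)).
  by apply: measurableI; apply: measurableI => //; exact: measurable_annulus.
pose side b := [set z | I z /\ (0 <= cross (z - x) (x' - x)) = b].
have side_small b : exists Q : set (plane R),
    [/\ measurable Q, side b `<=` Q & (mu Q <= (32 * s ^+ 8)%:E)%E].
  (* Any point of the piece serves as the centre. *)
  have [[y [Iy yb]]|nb] := pselect (exists y, side b y); last first.
    exists set0; split => //; first by move=> z hz; case: nb; exists z.
    by rewrite measure0 lee_fin mulr_ge0// exprn_ge0// ltW.
  exists (cball2 y ((2 * s ^+ 2) ^+ 5)); split; first exact: measurable_cball2.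
    move=> z [Iz zb].
    have [[Ay _] [A'y _]] := Iy; have [[Az _] [A'z _]] := Iz.
    have /andP[_ r_s] := rs; have /andP[_ r'_s] := r's.
    apply: (@annuli_meet _ x x' y z r r' (s ^+ 30) (s ^+ 10)) => //.
    - exact: le_trans s1.
    - exact: le_trans s1.
    - by rewrite exprn_gt0.
    - by rewrite ler_wiXn2l// ltW.
    - by rewrite exprn_ile1// ltW.
    - by rewrite exprn_ge0// mulr_ge0// exprn_ge0// ltW.
    - have -> : s ^+ 10 * ((2 * s ^+ 2) ^+ 5) ^+ 2 = 1024 * s ^+ 30 by ring.
      by rewrite ler_wpM2r ?exprn_ge0// ?ltW//; lra.
    - exact: annulus_shell.
    - exact: annulus_shell.
    - exact: annulus_shell.
    - exact: annulus_shell.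
    - case: b yb zb => [yb zb|/negbT yb /negbT zb]; first by rewrite mulr_ge0.
      by rewrite -ltNge in yb; rewrite -ltNge in zb; rewrite mulr_le0// ltW.
  have -> : 32 * s ^+ 8 = 2 * (2 * s ^+ 2) ^+ 4 by ring.
  apply: hT; first by have [[]] := Iy.
  by rewrite st0 andbT mulr_gt0// exprn_gt0.
have [Q1 [mQ1 sQ1 hQ1]] := side_small true.
have [Q2 [mQ2 sQ2 hQ2]] := side_small false.
apply: (@le_trans _ _ (mu (Q1 `|` Q2))).
  apply: le_measure; rewrite ?inE//; first exact: measurableU.
  move=> z Iz; case e : (0 <= cross (z - x) (x' - x)).
  - by left; apply: sQ1; split.
  - by right; apply: sQ2; split.
apply: (le_trans (measureU2 mu mQ1 mQ2)); apply: (le_trans (leeD hQ1 hQ2)).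
by rewrite -EFinD lee_fin; have -> : 32 * s ^+ 8 + 32 * s ^+ 8 = 64 * s ^+ 8 by ring.
Qed.

(** The counting argument. Let c be the outer measure of S. At a suitable small
    dyadic scale s, the centres with a radius in (s/2, s] have outer measure
    larger than c s/4 ([heavy_piece]) while balls of radius s^10 have mass at
    most 2 s^8, so that N centres can be chosen at mutual distances larger than
    s^10, with N between 16/(k s^3) and 24/(k s^3). The N annuli have masses at
    least m = k (s/2)^3 with 2 < N m, whereas their pairwise intersections
    contribute at most N^2 64 s^8 < 1. *)
Lemma thin_annuli_negligible {R : realType} (mu : probability (plane R) R)
    (T S : set (R * R)) (t0 k : R) :
  measurable (T : set (plane R)) -> S `<=` T -> 0 < t0 -> 0 < k ->
  (forall z, T z -> forall t, 0 < t < t0 ->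
    (mu (cball2 z (t ^+ 5)) <= (2 * t ^+ 4)%:E)%E) ->
  (forall x, S x -> forall e, 0 < e -> exists2 r, 0 < r < e &
    ((k * r ^+ 3)%:E <= mu (annulus x r 30 `&` T))%E) ->
  mu.-negligible S.
Proof.
move=> mT ST t00 k0 hT hS; apply: mu_ext_eq0_negligible.
apply/eqP/negPn/negP => S0.
have {}S0 : (0 < (mu^*)%mu S)%E by rewrite lt0e S0 mu_ext_ge0.
have Sle1 : ((mu^*)%mu S <= 1)%E.
  apply: (@le_trans _ _ ((mu^*)%mu setT)); first exact: le_mu_ext.
  rewrite measurable_mu_extE; last exact: measurableT.
  exact: probability_le1.
have Sfin : (mu^*)%mu S \is a fin_num.
  by rewrite ge0_fin_numE ?mu_ext_ge0// (le_lt_trans Sle1)// ltry.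
set c := fine ((mu^*)%mu S).
have c0 : 0 < c by rewrite fine_gt0// S0 ltey_eq Sfin.
(* Below s0 all the numerical inequalities of the count hold. *)
have [s0 [s00 [s01 ks0] s0t s0k s0c]] : exists s0 : R,
    [/\ 0 < s0, s0 <= 1 /\ k * s0 <= 1, 2 * s0 <= t0, 200 * s0 <= k & 200 * s0 <= c * k].
  have ck := mulr_gt0 c0 k0.
  pose u := Num.min (Num.min (Num.min 1 k^-1) (t0 / 2)) (Num.min (k / 200) (c * k / 200)).
  have [[u1 u5] u2 u3 u4] : [/\ u <= 1 /\ u <= k^-1, u <= t0 / 2, u <= k / 200 & u <= c * k / 200].
    by rewrite /u; do ?split; rewrite !ge_min lexx ?orbT.
  exists u; split; try lra.
    by rewrite /u !lt_min ltr01 invr_gt0 k0 !divr_gt0.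
  by split => //; rewrite -ler_pdivlMl// mulr1.
have [K hK] := exists_half_exp_lt s0 s00.
pose scale n : R := 2^-1 ^+ (K + n).
pose E n := [set x | S x /\ exists2 r, scale n / 2 < r <= scale n &
   ((k * r ^+ 3)%:E <= mu (annulus x r 30 `&` T))%E].
have SE : S `<=` \bigcup_n E n.
  move=> x Sx; have [r /andP[r0 rK] hr] := hS x Sx (2^-1 ^+ K) (half_exp_gt0 _).
  have r01 : 0 < r <= 1.
    by rewrite r0 /= ltW// (lt_trans rK)// (lt_le_trans hK).
  have [j /andP[j1 j2]] := dyadic_scale r r01.
  have Kj : (K <= j)%N.
    rewrite -ltnS ltnNge; apply/negP => jK.
    have := lt_trans j1 rK; apply/negP; rewrite -leNgt; exact: half_exp_le.
  exists (j - K)%N => //; split => //; exists r => //.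
  by rewrite /scale subnKC// j2 andbT -exprSr.
have [n hn] := heavy_piece _ _ _ _ _ S0 Sfin SE.
set s := scale n.
have ss0 : 0 < s by exact: half_exp_gt0.
have s_s0 : s < s0 by apply: le_lt_trans hK; exact/half_exp_le/leq_addr.
have {}hn : ((c * s / 4)%:E < (mu^*)%mu (E n))%E.
  apply: le_lt_trans hn; rewrite lee_fin -mulrA ler_wpM2l ?(ltW c0)//.
  have -> : ((2 ^ n.+2)%:R : R)^-1 = 2^-1 ^+ n / 4.
    by rewrite natrX -exprVn 2!exprSr -mulrA; congr (_ * _); field.
  by rewrite ler_wpM2r ?invr_ge0// /s /scale half_exp_le// leq_addl.
pose m := k * (s / 2) ^+ 3.
have m0 : 0 < m by rewrite mulr_gt0// exprn_gt0// divr_gt0.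
pose N := (Num.truncn (2 / m)).+1.
have Nm2 : 2 < N%:R * m by rewrite -ltr_pdivrMr// truncnS_gt.
have s1 : s <= 1 by lra.
have s3 : s ^+ 3 <= s by rewrite exprS ler_piMr ?(ltW ss0)// exprn_ile1// ltW.
have Nm3 : N%:R * m <= 3.
  have : (Num.truncn (2 / m))%:R * m <= 2.
    by rewrite -ler_pdivlMr// truncn_le divr_ge0// ltW.
  rewrite /N -natr1 mulrDl mul1r.
  suff : m <= 1 by lra.
  have -> : m = k * s ^+ 3 / 8 by rewrite /m; field.
  have : k * s ^+ 3 <= k * s0 by rewrite ler_pM2l// (le_trans s3)// ltW.
  lra.
have Nk : N%:R * k * s ^+ 3 <= 24.
  have e : N%:R * m = N%:R * k * s ^+ 3 / 8 by rewrite /m; field.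
  by move: Nm3; rewrite e; lra.
have N0 : (0 : R) < N%:R by [].
have Nq : N%:R * (2 * s ^+ 8) < c * s / 4.
  rewrite -(ltr_pM2l k0).
  have -> : k * (N%:R * (2 * s ^+ 8)) = N%:R * k * s ^+ 3 * (2 * s ^+ 3 * s ^+ 2) by ring.
  apply: (@le_lt_trans _ _ (24 * (2 * s ^+ 3 * s ^+ 2))).
    by rewrite ler_wpM2r// mulr_ge0 ?mulr_ge0 ?exprn_ge0// ltW.
  have -> : k * (c * s / 4) = s * (c * k / 4) by field.
  have -> : 24 * (2 * s ^+ 3 * s ^+ 2) = s * (48 * (s * s ^+ 3)) by ring.
  rewrite ltr_pM2l//.
  have : s * s ^+ 3 <= s by rewrite ler_piMr ?(ltW ss0)// exprn_ile1// ltW.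
  lra.
have Nq2 : N%:R ^+ 2 * (64 * s ^+ 8) < 1.
  rewrite -(ltr_pM2l (exprn_gt0 2 k0)) mulr1.
  have -> : k ^+ 2 * (N%:R ^+ 2 * (64 * s ^+ 8)) =
    (N%:R * k * s ^+ 3) ^+ 2 * (64 * s ^+ 2) by ring.
  apply: (@le_lt_trans _ _ (24 ^+ 2 * (64 * s ^+ 2))).
    rewrite ler_wpM2r ?mulr_ge0 ?exprn_ge0 ?(ltW ss0)//.
    by rewrite lerXn2r// nnegrE// !mulr_ge0 ?exprn_ge0 ?ler0n// ltW.
  have -> : 24 ^+ 2 * (64 * s ^+ 2) = (192 * s) ^+ 2 by ring.
  by rewrite ltr_pXn2r// ?nnegrE; lra.
have s8 : 0 < s ^+ 8 by rewrite exprn_gt0.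
have [f [fE fsep]] : exists f : nat -> R * R, (forall i, (i < N)%N -> E n (f i)) /\
    forall i j, (i < j < N)%N -> s ^+ 10 < norm2 (f i - f j).
  apply: (separated_family _ mu _ _ (2 * s ^+ 8)).
  - move=> x [Sx _]; have -> : s ^+ 10 = (s ^+ 2) ^+ 5 by ring.
    have -> : s ^+ 8 = (s ^+ 2) ^+ 4 by ring.
    apply: hT; first exact: ST.
    rewrite exprn_gt0//=; nra.
  - lra.
  - by apply: lt_trans hn; rewrite lte_fin.
have [r rP] : {r : nat -> R & forall i, (i < N)%N -> s / 2 < r i <= s /\
    ((k * r i ^+ 3)%:E <= mu (annulus (f i) (r i) 30 `&` T))%E}.
  apply: (@choice _ _ (fun i t => (i < N)%N -> s / 2 < t <= s /\
    ((k * t ^+ 3)%:E <= mu (annulus (f i) t 30 `&` T))%E)) => i.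
  have [iN|iN] := boolP (i < N)%N; last by exists 0.
  by have [_ [t ht h]] := fE i iN; exists t.
have r_s i : (i < N)%N -> 0 < r i <= s.
  by move=> /rP[/andP[h1 ->] _]; rewrite andbT; lra.
have := bonferroni _ _ _ mu (fun i => annulus (f i) (r i) 30 `&` T) m (64 * s ^+ 8) N.
have h1 i : measurable (annulus (f i) (r i) 30 `&` T : set (plane R)).
  by apply: measurableI => //; exact: measurable_annulus.
have h2 i : (i < N)%N -> (m%:E <= mu (annulus (f i) (r i) 30 `&` T))%E.
  move=> iN; have [/andP[sr _] hr] := rP i iN; apply: le_trans hr.
  rewrite lee_fin ler_wpM2l ?(ltW k0)// lerXn2r ?nnegrE ?(ltW sr)//; lra.
have h3 i j : (i < j < N)%N -> (mu ((annulus (f i) (r i) 30 `&` T) `&`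
    (annulus (f j) (r j) 30 `&` T)) <= (64 * s ^+ 8)%:E)%E.
  move=> /[dup] ijN /andP[ij jN].
  apply: (annuli_meet_measure mu T t0) => //.
  - by rewrite ss0.
  - nra.
  - exact/r_s/(ltn_trans ij).
  - exact: r_s.
  - exact/ltW/fsep.
have h4 : 0 <= 64 * s ^+ 8 by lra.
move=> /(_ h1 h2 h3 h4); lra.
Qed.

(** * Regular points and the conclusion *)

(** The radius is t^5 in the upper bound so that mu (B(x, r)) <= r^(4/5) can be
    written, and used, without real exponents. *)
Definition regular {R : realType} (mu : probability (plane R) R) (s : R) :
    set (R * R) :=
  [set x | forall t, 0 < t < s -> (mu (cball2 x (t ^+ 5)) <= (t ^+ 4)%:E)%E /\
                                  ((t ^+ 3)%:E <= mu (cball2 x t))%E].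

(** The exponents 4/5 < 0.89 and 3 > 2 leave a margin on both sides of the
    dimensions of mu. *)
Lemma ae_regular {R : realType} (mu : probability (plane R) R) (dlow dup : R) :
  4 / 5 < dlow -> dup < 3 -> lower_dim mu = dlow%:E -> upper_dim mu = dup%:E ->
  mu.-negligible [set x | forall j, ~ regular mu (2^-1 ^+ j) x].
Proof.
move=> hl hu hlow hup.
have : ((4 / 5)%:E < lower_dim mu)%E by rewrite hlow lte_fin.
move=> /ereal_sup_gt[_ [a [a0 aeA] <-]]; rewrite lte_fin => ha.
have : (upper_dim mu < 3%:E)%E by rewrite hup lte_fin.
move=> /ereal_inf_lt[_ [b [b0 aeB] <-]]; rewrite lte_fin => hb.
apply: negligibleS (negligibleU aeA aeB) => x nx.
apply: contrapT => /not_orP[/contrapT[rA rA0 hA] /contrapT[rB rB0 hB]].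
pose u := Num.min (Num.min rA rB) 1.
have [uA uB u1] : [/\ u <= rA, u <= rB & u <= 1].
  by rewrite /u; split; rewrite !ge_min lexx ?orbT.
have u0 : 0 < u by rewrite /u !lt_min rA0 rB0 ltr01.
have [j hj] := exists_half_exp_lt u u0; apply: (nx j) => t /andP[t0 tj].
have t1 : t < 1 by lra.
have t5 : t ^+ 5 <= t by rewrite exprS ler_piMr ?(ltW t0)// exprn_ile1// ltW.
have t50 : 0 < t ^+ 5 by rewrite exprn_gt0.
split.
- apply: (le_trans (hA (t ^+ 5) _)); first by rewrite t50 /=; lra.
  rewrite lee_fin -powR_mulrn ?(ltW t0)// -powRrM -powR_mulrn ?(ltW t0)//.
  by apply: ger_powR; [rewrite t0 ltW|lra].
- apply: (le_trans _ (hB t _)); last by rewrite t0 /=; lra.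
  rewrite lee_fin -powR_mulrn ?(ltW t0)//.
  by apply: ger_powR; [rewrite t0 ltW|lra].
Qed.

(** A ball centred in the closure lies in a slightly larger ball centred at a
    regular point; the factor 11/10 satisfies (11/10)^5 >= 3/2 and
    (11/10)^4 <= 2. *)
Lemma closure_regular {R : realType} (mu : probability (plane R) R) (s t : R) (z : R * R) :
  closure (regular mu s) z -> 0 < t < s / 2 ->
  (mu (cball2 z (t ^+ 5)) <= (2 * t ^+ 4)%:E)%E.
Proof.
move=> hz /andP[t0 ts].
have t50 : 0 < t ^+ 5 by rewrite exprn_gt0.
have e0 : 0 < t ^+ 5 / 4 by rewrite divr_gt0.
have [g [Gg /= [g1 g2]]] := hz _ (nbhsx_ballx z _ e0).
rewrite /ball /= in g1 g2.
have gz : norm2 (g - z) <= t ^+ 5 / 2.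
  rewrite norm2_le ?divr_ge0 ?(ltW t50)//=.
  move: g1 g2; rewrite !ltr_norml; move: (t ^+ 5) t50 e0 => v v0 e0.
  by move=> /andP[? ?] /andP[? ?]; nra.
apply: (@le_trans _ _ (mu (cball2 g ((11 / 10 * t) ^+ 5)))).
  apply: le_measure; rewrite ?inE; [exact: measurable_cball2|exact: measurable_cball2|].
  apply: le_cball2; apply: (@le_trans _ _ (t ^+ 5 / 2 + t ^+ 5)); first by rewrite lerD2r.
  by rewrite exprMn; lra.
have [|h _] := Gg (11 / 10 * t); first by lra.
apply: (le_trans h); rewrite lee_fin exprMn ler_wpM2r ?exprn_ge0 ?(ltW t0)//; lra.
Qed.

Theorem theorem1p7 (R : realType) (dlow dup : R)
    (hdup : 89%:R / 100%:R <= dup <= 2)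
    (hdlow : 89%:R / 100%:R <= dlow <= dup)
    (mu : probability (plane R) R) (hradon : radon mu)
    (hlow : lower_dim mu = dlow%:E) (hup : upper_dim mu = dup%:E) :
  forall eta : R, 0 < eta < 1 -> mu.-negligible (Emu mu 30 eta).
Proof.
move=> eta /andP[eta0 _].
pose G j := regular mu (2^-1 ^+ j).
pose T j := closure (G j).
have mT j : measurable (T j : set (plane R)).
  rewrite -(setCK (T j)); apply: measurableC; apply: open_measurable_plane.
  exact/closed_openC/closed_closure.
(* Exceptional annuli can escape [T j] only around these points. *)
pose leaky j := [set x | G j x /\ forall e, 0 < e -> exists2 r, 0 < r < e &
   ((eta / 2)%:E * mu (cball2 x r) <= mu (cball2 x r `\` T j))%E].
have leaky0 j : mu.-negligible (leaky j).
  apply: (density_negligible _ mu (T j) (leaky j) (eta / 2)) => //.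
  - exact: closed_closure.
  - by move=> x [Gx _]; exact: subset_closure.
  - by rewrite divr_gt0.
  - by move=> x [].
have rest0 j : mu.-negligible ((G j `&` Emu mu 30 eta) `\` leaky j).
  apply: (thin_annuli_negligible mu (T j) _ (2^-1 ^+ j / 2) (eta / 2)) => //.
  - by move=> x [[Gx _] _]; exact: subset_closure.
  - by rewrite divr_gt0.
  - by move=> z Tz t; exact: closure_regular.
  move=> x [[Gx [r [r01 rcvg hr]]] nd] e e0.
  have [e1 e10 he1] : exists2 e1, 0 < e1 & forall t, 0 < t < e1 ->
      (mu (cball2 x t `\` T j) < (eta / 2)%:E * mu (cball2 x t))%E.
    apply: contrapT => nex; apply: nd; split => // e1 e10.
    apply: contrapT => nex2; apply: nex; exists e1 => // t te1.
    by rewrite ltNge; apply/negP => h; apply: nex2; exists t.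
  pose u := Num.min (Num.min e e1) (2^-1 ^+ j).
  have [ue ue1 uj] : [/\ u <= e, u <= e1 & u <= 2^-1 ^+ j].
    by rewrite /u; split; rewrite !ge_min lexx ?orbT.
  have u0 : 0 < u by rewrite /u !lt_min e0 e10 half_exp_gt0.
  move: rcvg => /cvgrPdist_lt /(_ u u0)[n _ /(_ n (leqnn n))] /=.
  have /andP[rn0 _] := r01 n.
  rewrite sub0r normrN gtr0_norm// => rnu.
  exists (r n); first by rewrite rn0 (lt_le_trans rnu).
  (* The part of the ball outside [T j] takes less than half of the mass that
     the annulus must have, so that the other half is inside [T j]. *)
  pose A := annulus x (r n) 30; pose B := cball2 x (r n).
  have hAB : (eta%:E * mu B <= mu A)%E := hr n.
  rewrite -/A.
  have mA : measurable (A : set (plane R)) by exact: measurable_annulus.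
  have mB : measurable (B : set (plane R)) by exact: measurable_cball2.
  have [|_ hB] := Gx (r n); first by rewrite rn0 (lt_le_trans rnu).
  have hBT : (mu (B `\` T j) < (eta / 2)%:E * mu B)%E.
    by apply: he1; rewrite rn0 (lt_le_trans rnu).
  have hAT : (mu (A `\` T j) <= mu (B `\` T j))%E.
    apply: le_measure; rewrite ?inE; [exact: measurableD|exact: measurableD|].
    by apply: setSD => y [].
  have eA : mu A = (mu (A `\` T j) + mu (A `&` T j))%E by exact: measureDI.
  have mAT : measurable (A `&` T j : set (plane R)) by exact: measurableI.
  have mAD : measurable (A `\` T j : set (plane R)) by exact: measurableD.
  have mBD : measurable (B `\` T j : set (plane R)) by exact: measurableD.
  move: eA hAT hBT hB hAB.
  rewrite -(fineK (fin_num_measure mu _ mA)) -(fineK (fin_num_measure mu _ mB)).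
  rewrite -(fineK (fin_num_measure mu _ mAT)) -(fineK (fin_num_measure mu _ mAD)).
  rewrite -(fineK (fin_num_measure mu _ mBD)) -!EFinM -EFinD !lee_fin lte_fin.
  move=> [->] h1 h2 h3 h4.
  have : eta / 2 * r n ^+ 3 <= eta / 2 * fine (mu B).
    by rewrite ler_wpM2l// divr_ge0// ltW.
  move: h1 h2 h4; clear; lra.
have cover : Emu mu 30 eta `<=` [set x | forall j, ~ G j x] `|`
    \bigcup_j (leaky j `|` ((G j `&` Emu mu 30 eta) `\` leaky j)).
  move=> x Ex; have [nG|/existsNP[j /contrapT Gx]] := pselect (forall j, ~ G j x).
    by left.
  right; exists j => //.
  by have [dx|ndx] := pselect (leaky j x); [left|right].
apply: (@negligibleS _ _ _ mu _ _ cover); apply: negligibleU.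
  by apply: (ae_regular mu dlow dup) => //; lra.
by apply: negligible_bigcup => j; exact: negligibleU.
Qed.
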